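(* Let $I$ be a finite set and let $(E_i)_{i\in I}$ be a family of non necessarily finite sets, $E=\prod_{i\in I}E_i$. Let $\mathcal{A},\mathcal{B}\subseteq\mathcal{P}(I)$, let $f:E\to\mathbb{R}_{>0}$, and let $(f_a)_{a\in\mathcal{A}}\in\prod_{a\in\mathcal{A}}\mathbb{R}_{>0}^{E_a}$ and $(g_b)_{b\in\mathcal{B}}\in\prod_{b\in\mathcal{B}}\mathbb{R}_{>0}^{E_b}$ be such that for all $x\in E$, $$f(x)=\prod_{a\in\mathcal{A}}f_a(x_a)=\prod_{b\in\mathcal{B}}g_b(x_b).$$ Then there is $(h_{a,b})_{(a,b)\in\mathcal{A}\times\mathcal{B}}\in\prod_{(a,b)\in\mathcal{A}\times\mathcal{B}}\mathbb{R}_{>0}^{E_{a\cap b}}$ such that for all $x\in E$, $$f(x)=\prod_{(a,b)\in\mathcal{A}\times\mathcal{B}}h_{a,b}(x_{a\cap b}).$$ Equivalently, for all $\mathcal{A},\mathcal{B}\subseteq\mathcal{P}(I)$, $\mathcal{F}_{\mathcal{A}}\cap\mathcal{F}_{\mathcal{B}}\subseteq\mathcal{F}_{\mathcal{A}\sqcap\mathcal{B}}$.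
   Context: $\mathcal{P}(I)$ is the power set of $I$. For $a\subseteq I$, $E_a=\prod_{i\in a}E_i$ ($E_\emptyset$ a one-point set), and $x_a$ is the projection of $x\in E$ onto $E_a$. For $\mathcal{A},\mathcal{B}\subseteq\mathcal{P}(I)$, $\mathcal{A}\sqcap\mathcal{B}=\{a\cap b: a\in\mathcal{A},\ b\in\mathcal{B}\}$. For $\mathcal{A}\subseteq\mathcal{P}(I)$, the factorisation space $\mathcal{F}_{\mathcal{A}}$ is the set of $f:E\to\mathbb{R}_{>0}$ for which there exist $f_a:E_a\to\mathbb{R}_{>0}$ ($a\in\mathcal{A}$) with $f(x)=\prod_{a\in\mathcal{A}}f_a(x_a)$ for all $x\in E$. Empty products equal $1$. *)

(* Defs.v *)
From HB Require Import structures.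
From mathcomp Require Import all_boot all_order all_algebra.
From mathcomp Require Import classical_sets reals interval_inference.

Set Implicit Arguments.
Unset Strict Implicit.
Unset Printing Implicit Defensive.

Import Order.TTheory GRing.Theory Num.Theory.
Local Open Scope ring_scope.

(* The factors [E i] are arbitrary types: infinite or empty ones are allowed. *)
Definition fullprod (I : finType) (E : I -> Type) : Type := forall i : I, E i.

Definition subprod (I : finType) (E : I -> Type) (a : {set I}) : Type :=
  forall i : {i : I | i \in a}, E (val i).

Definition proj (I : finType) (E : I -> Type) (a : {set I}) (x : fullprod E) :
    subprod E a :=
  fun i => x (val i).
Arguments proj {I E} a x.

(* The family [fa] is indexed by all of [{set I}], but only its members at
   [a \in A] enter the product; the others are dummies, and taking them
   constant extends any family indexed by [A]. *)
Definition factorisation_space (R : realType) (I : finType) (E : I -> Type)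
    (A : {set {set I}}) : set (fullprod E -> {posnum R}) :=
  [set f | exists fa : forall a : {set I}, subprod E a -> {posnum R},
     forall x : fullprod E,
       (f x)%:num = \prod_(a in A) (fa a (proj a x))%:num]%classic.
Arguments factorisation_space R {I} E A.

Definition set_meets (I : finType) (A B : {set {set I}}) : {set {set I}} :=
  [set a :&: b | a in A, b in B]%SET.

(* Main.v *)
Require Import Defs.
From HB Require Import structures.
From mathcomp Require Import all_boot all_order all_algebra.
From mathcomp Require Import boolp classical_sets reals interval_inference.

(** The idea is to eliminate the sets of [A] one at a time by freezing
    coordinates.  Fix a base point [z] of [E] (if [E] is empty there is nothing
    to prove) and let [mask z a x] agree with [x] on [a] and with [z] off [a].
    Suppose [f = prod_(a in A) fa = prod_(b in B) gb], and pick [a1] in [A].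
    Split [f x] as [f (mask z a1 x)] times [f' x = f x / f (mask z a1 x)].

    In the first piece, expanded through [gb], the factor
    [gb b (proj b (mask z a1 x))] sees only the coordinates of [x] in
    [a1 :&: b]: these are the factors [h a1 b].

    The second piece [f'] again has a factorisation over [B], because each
    [gb b] is merely replaced by [gb b (x_b) / gb b ((mask z a1 x)_b)], which is
    a function of [x_b].  It has one over [A] as well, and there the factor of
    [a1] is [1], since [x] and [mask z a1 x] agree on [a1].  So [f'] factorises
    over [A :\ a1] and over [B], and induction applies
    ([factorisation_meets_seq]).  The inclusion of factorisation spaces follows
    by grouping the pairs [(a, b)] according to [a :&: b]
    ([factorisation_set_meets]). *)

Set Implicit Arguments.
Unset Strict Implicit.
Unset Printing Implicit Defensive.

Import Order.TTheory GRing.Theory Num.Theory.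
Local Open Scope ring_scope.

(** * Freezing coordinates at a base point *)

Section Mask.
Variables (I : finType) (E : I -> Type) (z : fullprod E).
Implicit Types (a b c : {set I}) (x : fullprod E).

Definition mask a x : fullprod E := fun i => if i \in a then x i else z i.

Definition extend a (y : subprod E a) : fullprod E :=
  fun i => if decP (@idP (i \in a)) is left ia then y (exist _ i ia) else z i.

Lemma extend_proj a x : extend (proj a x) = mask a x.
Proof.
apply: functional_extensionality_dep => i; rewrite /extend /mask.
by case: decP => [ia|/negP/negPf->] /=; rewrite ?ia.
Qed.

Lemma eq_proj a x x' : (forall i, i \in a -> x i = x' i) -> proj a x = proj a x'.
Proof. by move=> eqx; apply: functional_extensionality_dep => -[i ia]; exact: eqx. Qed.

Lemma proj_mask_sub a c x : a \subset c -> proj a (mask c x) = proj a x.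
Proof. by move=> /fintype.subsetP ac; apply: eq_proj => i /ac; rewrite /mask => ->. Qed.

Lemma proj_mask_mask a c x : proj a (mask c (mask a x)) = proj a (mask c x).
Proof. by apply: eq_proj => i ia; rewrite /mask ia. Qed.

Lemma proj_mask_setI c b x : proj b (mask (c :&: b) x) = proj b (mask c x).
Proof. by apply: eq_proj => i ib; rewrite /mask inE ib andbT. Qed.

End Mask.

(** * Factorisations *)

Section Factorisations.
Variables (R : numFieldType) (I : finType) (E : I -> Type) (z : fullprod E).
Implicit Types (a b c : {set I}) (A B : {set {set I}}) (s : seq {set I}).
Implicit Types x : fullprod E.

Local Notation family := (forall a : {set I}, subprod E a -> {posnum R}).
Implicit Type u : family.

(** The family of the quotient [f x / f (mask z c x)], for [f] the product of
    the family [u]. *)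
Definition unfreeze (c : {set I}) (u : family) : family :=
  fun a y => ((u a y)%:num / (u a (proj a (mask z c (extend z y))))%:num)%:pos.

Lemma unfreezeE c u a x : (unfreeze c u (proj a x))%:num =
  (u a (proj a x))%:num / (u a (proj a (mask z c x)))%:num.
Proof. by rewrite /= extend_proj proj_mask_mask. Qed.

Lemma unfreeze_sub c u a x : a \subset c -> (unfreeze c u (proj a x))%:num = 1.
Proof. by move=> ac; rewrite unfreezeE proj_mask_sub// divff. Qed.

Lemma prod_unfreeze (r : seq {set I}) (P : pred {set I}) c u x :
  \prod_(a <- r | P a) (unfreeze c u (proj a x))%:num =
  \prod_(a <- r | P a) (u a (proj a x))%:num /
  \prod_(a <- r | P a) (u a (proj a (mask z c x)))%:num.
Proof. by rewrite -prodf_div; apply: eq_bigr => j _; exact: unfreezeE. Qed.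

(** The first factorisation is indexed by a sequence so that its members can be
    eliminated in turn; both factorisations change at each step. *)
Lemma factorisation_meets_seq s B (fa gb : family) :
    uniq s ->
    (forall x, \prod_(a <- s) (fa a (proj a x))%:num =
               \prod_(b in B) (gb b (proj b x))%:num) ->
  exists h : forall a b : {set I}, subprod E (a :&: b) -> {posnum R},
    forall x, \prod_(b in B) (gb b (proj b x))%:num =
      \prod_(a <- s) \prod_(b in B) (h a b (proj (a :&: b) x))%:num.
Proof.
elim: s fa gb => [|c s IHs] fa gb /=.
  by move=> _ fg; exists (fun _ _ _ => 1%:pos) => x; rewrite -fg !big_nil.
move=> /andP[cs us] fg.
have [x|h hP] := IHs (unfreeze c fa) (unfreeze c gb) us.
  (* adding back the factor of [c], which is 1, gives a quotient of products
     to which [fg] applies *)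
  have := prod_unfreeze (c :: s) xpredT c fa x.
  by rewrite big_cons unfreeze_sub// mul1r => ->; rewrite !fg prod_unfreeze.
exists (fun a b y =>
  if a == c then gb b (proj b (extend z y)) else h a b y) => x.
rewrite big_cons eqxx.
under [X in _ = X * _]eq_bigr do rewrite extend_proj proj_mask_setI.
under [X in _ = _ * X]eq_big_seq => a sa.
  have /negPf -> : a != c by apply: contraNneq cs => <-.
  over.
rewrite -hP prod_unfreeze mulrC divfK//.
by apply/prodf_neq0 => b _; exact: lt0r_neq0.
Qed.

Lemma factorisation_set_meets A B
    (h : forall a b : {set I}, subprod E (a :&: b) -> {posnum R}) :
  exists k : family, forall x,
    \prod_(ab in finset.setX A B) (h ab.1 ab.2 (proj (ab.1 :&: ab.2) x))%:num =
    \prod_(c in set_meets A B) (k c (proj c x))%:num.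
Proof.
(* [extend] serves here to transport along [ab.1 :&: ab.2 = c]; the base point
   is never seen. *)
pose K c (y : subprod E c) :=
  \prod_(ab in finset.setX A B | ab.1 :&: ab.2 == c)
    (h ab.1 ab.2 (proj (ab.1 :&: ab.2) (extend z y)))%:num.
have K_gt0 c y : 0 < K c y by exact: prodr_gt0.
exists (fun c y => PosNum (K_gt0 c y)) => x.
rewrite (partition_big (fun ab => ab.1 :&: ab.2) (mem (set_meets A B))) /=.
  apply: eq_bigr => c _; apply: eq_bigr => ab /andP[_ /eqP abc].
  by rewrite extend_proj proj_mask_sub ?abc.
by move=> [a b] /setXP[aA bB]; exact: imset2_f.
Qed.

End Factorisations.

Lemma factorisation_meets (R : numFieldType) (I : finType) (E : I -> Type)
    (A B : {set {set I}}) (f : fullprod E -> {posnum R})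
    (fa gb : forall a : {set I}, subprod E a -> {posnum R}) :
    (forall x, (f x)%:num = \prod_(a in A) (fa a (proj a x))%:num) ->
    (forall x, (f x)%:num = \prod_(b in B) (gb b (proj b x))%:num) ->
  exists h : forall a b : {set I}, subprod E (a :&: b) -> {posnum R},
    forall x, (f x)%:num =
      \prod_(ab in finset.setX A B) (h ab.1 ab.2 (proj (ab.1 :&: ab.2) x))%:num.
Proof.
move=> fA fB.
have [[z]|E0] := pselect (inhabited (fullprod E)); last first.
  by exists (fun _ _ _ => 1%:pos) => x; case: E0.
have [x|h hP] := @factorisation_meets_seq R I E z (enum A) B fa gb (enum_uniq _).
  by rewrite big_enum -fA fB.
exists h => x; rewrite fB hP big_enum /= pair_big /=.
by apply: eq_bigl => -[a b]; rewrite finset.in_setX.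
Qed.

Theorem theorem3p1 (R : realType) (I : finType) (E : I -> Type) :
  (forall (A B : {set {set I}}) (f : fullprod E -> {posnum R})
      (fa : forall a : {set I}, subprod E a -> {posnum R})
      (gb : forall b : {set I}, subprod E b -> {posnum R}),
    (forall x : fullprod E, (f x)%:num = \prod_(a in A) (fa a (proj a x))%:num) ->
    (forall x : fullprod E, (f x)%:num = \prod_(b in B) (gb b (proj b x))%:num) ->
    exists h : forall a b : {set I}, subprod E (a :&: b) -> {posnum R},
      forall x : fullprod E,
        (f x)%:num =
        \prod_(ab in finset.setX A B) (h ab.1 ab.2 (proj (ab.1 :&: ab.2) x))%:num)
  /\
  (forall A B : {set {set I}},
    (factorisation_space R E A `&` factorisation_space R E B `<=`
     factorisation_space R E (set_meets A B))%classic).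
Proof.
split=> [A B f fa gb|A B f [[fa fA] [gb fB]]]; first exact: factorisation_meets.
have [h hP] := factorisation_meets fA fB.
have [[z]|E0] := pselect (inhabited (fullprod E)); last first.
  by exists (fun _ _ => 1%:pos) => x; case: E0.
have [k kP] := factorisation_set_meets z A B h.
by exists k => x; rewrite hP kP.
Qed.
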